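(* Let $X$ be an infinite-dimensional complex Banach space and $T\in L(X)$ be such that $\sigma_{su}(T)=\partial\sigma(T)$ and no point of $\partial\sigma(T)$ is isolated in $\sigma(T)$. Then $$\sigma_{ec}(T)\subset\sigma_{su}(T)=\sigma_{gKR}(T)=\sigma_{gK}(T)=\sigma_{Kt}(T)=\sigma_{eK}(T)=\sigma_K(T)=\sigma_{\mathbf{gDR}\mathcal Q}(T).$$
   Context: $\sigma_{su}(T)$ is the set of $\lambda$ with $T-\lambda$ not surjective; $\sigma_{ec}(T)=\{\lambda: R(T-\lambda)\text{ not closed}\}$. $S$ is Kato if $R(S)$ is closed and $N(S)\subset R(S^n)$ for all $n$; $S$ is Riesz if $S-\lambda$ is Fredholm for all $\lambda\ne0$. For an operator $S$ and closed $S$-invariant $M,N$ with $X=M\oplus N$ and $S_M$ Kato: if $S_N$ is Riesz, $S$ admits a GKRD; if $S_N$ is quasinilpotent, a GKD; if $S_N$ is nilpotent, $S$ is of Kato type; if $N$ is finite-dimensional and $S_N$ nilpotent, $S$ is essentially Kato. $\sigma_{gKR}$, $\sigma_{gK}$, $\sigma_{Kt}$, $\sigma_{eK}$, $\sigma_K$: sets of $\lambda$ with $T-\lambda$ not admitting a GKRD, not admitting a GKD, not of Kato type, not essentially Kato, not Kato. $\sigma_{\mathbf{gDR}\mathcal Q}(T)$ is the set of $\lambda$ for which there are no closed $(T-\lambda)$-invariant $M,N$ with $X=M\oplus N$, $(T-\lambda)_M$ surjective and $(T-\lambda)_N$ Riesz. *)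

(* Defs.v *)
From HB Require Import structures.
From mathcomp Require Import all_boot all_order all_algebra.
From mathcomp Require Import all_classical all_reals all_analysis.
From mathcomp.real_closed Require Export complex.
Import Order.TTheory GRing.Theory Num.Theory.
Import numFieldNormedType.Exports.
Set Implicit Arguments. Unset Strict Implicit. Unset Printing Implicit Defensive.
Local Open Scope ring_scope.
Local Open Scope classical_set_scope.

(* The complex plane R[i] with the (metric) topology induced by its modulus. *)
#[non_forgetful_inheritance]
HB.instance Definition _ (R : rcfType) := PseudoPointedMetric.copy R[i] R[i]^o.

Definition boundary (T : topologicalType) (A : set T) : set T :=
  closure A `\` interior A.

Section OperatorNotions.
Context {K : numDomainType} {V : normedModType K}.

Definition span (s : seq V) : set V :=
  [set x | exists c : 'I_(size s) -> K, x = \sum_(i < size s) c i *: s`_i].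

Definition set_add (A B : set V) : set V :=
  [set x | exists a b, [/\ A a, B b & x = a + b]].

Definition fin_dim (A : set V) : Prop := exists s : seq V, A `<=` span s.

Definition subspace (A : set V) : Prop :=
  A 0 /\ forall (a : K) (x y : V), A x -> A y -> A (a *: x + y).

Definition invariant (S : V -> V) (A : set V) : Prop := S @` A `<=` A.

Definition direct_sum (M N : set V) : Prop :=
  [/\ subspace M, subspace N, M `&` N = [set 0] &
      forall x : V, exists a b, [/\ M a, N b & x = a + b]].

Definition shift (S : V -> V) (l : K) : V -> V := fun x => S x - l *: x.

Definition ker_on (S : V -> V) (N : set V) : set V := N `&` S @^-1` [set 0].

(* S_N (N closed, S-invariant) is Fredholm as an operator on N:
   finite-dimensional kernel, closed range of finite codimension in N *)
Definition Fredholm_on (S : V -> V) (N : set V) : Prop :=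
  [/\ fin_dim (ker_on S N), closed (S @` N) &
      exists s : seq V, {subset s <= N} /\ N `<=` set_add (S @` N) (span s)].

Definition Riesz_on (S : V -> V) (N : set V) : Prop :=
  forall l : K, l != 0 -> Fredholm_on (shift S l) N.

Definition Kato_on (S : V -> V) (M : set V) : Prop :=
  closed (S @` M) /\ forall n : nat, ker_on S M `<=` (iter n S) @` M.

Definition spectrum_on (S : V -> V) (N : set V) : set K :=
  [set l | ~ ((forall x y, N x -> N y -> shift S l x = shift S l y -> x = y)
              /\ shift S l @` N = N)].

Definition quasinilpotent_on (S : V -> V) (N : set V) : Prop :=
  spectrum_on S N `<=` [set 0].

Definition nilpotent_on (S : V -> V) (N : set V) : Prop :=
  exists n : nat, forall x, N x -> iter n S x = 0.

Definition surjective_on (S : V -> V) (M : set V) : Prop := S @` M = M.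

Definition decomposition (S : V -> V)
    (P Q : (V -> V) -> set V -> Prop) : Prop :=
  exists M N : set V,
    [/\ closed M, closed N, invariant S M & invariant S N] /\
    [/\ direct_sum M N, P S M & Q S N].

Definition Kato (S : V -> V) : Prop := Kato_on S setT.
Definition GKRD (S : V -> V) : Prop := decomposition S Kato_on Riesz_on.
Definition GKD (S : V -> V) : Prop := decomposition S Kato_on quasinilpotent_on.
Definition Kato_type (S : V -> V) : Prop := decomposition S Kato_on nilpotent_on.
Definition essentially_Kato (S : V -> V) : Prop :=
  decomposition S Kato_on (fun S N => fin_dim N /\ nilpotent_on S N).
Definition gDR_Q (S : V -> V) : Prop :=
  decomposition S surjective_on Riesz_on.

Definition spectrum (T : V -> V) : set K := [set l | ~ bijective (shift T l)].
Definition spectrum_su (T : V -> V) : set K :=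
  [set l | ~ (forall y, exists x, shift T l x = y)].
Definition spectrum_ec (T : V -> V) : set K :=
  [set l | ~ closed (range (shift T l))].
Definition spectrum_gKR (T : V -> V) : set K := [set l | ~ GKRD (shift T l)].
Definition spectrum_gK (T : V -> V) : set K := [set l | ~ GKD (shift T l)].
Definition spectrum_Kt (T : V -> V) : set K := [set l | ~ Kato_type (shift T l)].
Definition spectrum_eK (T : V -> V) : set K :=
  [set l | ~ essentially_Kato (shift T l)].
Definition spectrum_K (T : V -> V) : set K := [set l | ~ Kato (shift T l)].
Definition spectrum_gDRQ (T : V -> V) : set K := [set l | ~ gDR_Q (shift T l)].

End OperatorNotions.

(* Main.v *)
(* Write S = T - l with l in the boundary of the spectrum, and suppose X = M (+) N
   with S_M Kato and S_N Riesz.  Arbitrarily close to 0 there are v with S - v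
   bijective, hence bijective on M and on N.  A Kato operator that is a limit of
   such bijective perturbations is itself bijective, so S - v is bijective on M
   for all small v.  If l is not isolated, there are boundary points l + m of the
   spectrum with m != 0 small.  On N the operator S - m is Fredholm; restricted
   to the range of a high enough power it becomes Kato, hence bijective by the
   same principle, and it is nilpotent modulo that range, so S - m - v is bijective
   on N for all small v != 0.  Thus l + m is isolated in the spectrum. *)

Require Import Defs.
From HB Require Import structures.
From mathcomp Require Import all_boot all_order all_algebra.
From mathcomp Require Import all_classical all_reals all_analysis.
From mathcomp.real_closed Require Import complex.
From mathcomp Require Import ring lra.
Import Order.TTheory GRing.Theory Num.Theory.
(* [Defs] is imported again because the libraries shadow [shift], [span],
   [subspace] and [invariant]. *)
Import numFieldNormedType.Exports Defs.
Set Implicit Arguments. Unset Strict Implicit. Unset Printing Implicit Defensive.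
Local Open Scope ring_scope.
Local Open Scope classical_set_scope.

(** Each property in the theorem lies between surjectivity of [T - l] and the existence of a GKRD,
    so one implication closes the circle: at a non-surjective [l], a boundary point by hypothesis, a
    GKRD would produce an isolated boundary point. The obstacle is uniformity. A boundary point only
    provides bijective [S - v] for some arbitrarily small [v], with no control on their inverses.
    The control comes from the limit operator itself: once injective with closed range, it is
    bounded below by the open mapping theorem, hence so are all [S - v] with one constant, and
    bijectivity spreads from one small [v] to all of them. The nearby boundary point [l + m] exists
    because a punctured disc is connected: around [l] it contains spectral points, [l] not being
    isolated, and points outside the spectrum, [l] being on its boundary. *)

Definition rnorm {R : realType} {V : normedZmodType R[i]} (x : V) : R :=
  complex.Re `|x|.

(** * Real-valued norms and completeness with explicit rates *)

Section RealNorm.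
Context {R : realType}.

(** Norms over [R[i]] take values in [R[i]], whose order is partial. Being nonnegative reals, they
    lose nothing when replaced by their real parts, and estimates then live in the total order of
    [R]. *)
Lemma rnormE (V : normedZmodType R[i]) (x : V) : `|x| = ((rnorm x)%:C)%C.
Proof. by rewrite /rnorm RRe_real. Qed.

Lemma rnorm_ge0 (V : normedZmodType R[i]) (x : V) : 0 <= rnorm x.
Proof. by have := normr_ge0 x; rewrite rnormE lecE /= => /andP[]. Qed.

Lemma rnormD (V : normedZmodType R[i]) (x y : V) :
  rnorm (x + y) <= rnorm x + rnorm y.
Proof. by have := ler_normD x y; rewrite !rnormE -rmorphD /= lecR. Qed.

Lemma rnormN (V : normedZmodType R[i]) (x : V) : rnorm (- x) = rnorm x.
Proof. by rewrite /rnorm normrN. Qed.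

Lemma rnormB (V : normedZmodType R[i]) (x y : V) :
  rnorm (x - y) <= rnorm x + rnorm y.
Proof. by rewrite -(rnormN y); exact: rnormD. Qed.

Lemma rnorm_distC (V : normedZmodType R[i]) (x y : V) :
  rnorm (x - y) = rnorm (y - x).
Proof. by rewrite /rnorm distrC. Qed.

Lemma rnorm_triangle (V : normedZmodType R[i]) (y x z : V) :
  rnorm (x - z) <= rnorm (x - y) + rnorm (y - z).
Proof. by rewrite (_ : x - z = (x - y) + (y - z)) ?rnormD ?addrA ?subrK. Qed.

Lemma rnorm0 (V : normedZmodType R[i]) : rnorm (0 : V) = 0.
Proof. by rewrite /rnorm normr0. Qed.

Lemma rnorm_eq0 (V : normedZmodType R[i]) (x : V) : rnorm x = 0 -> x = 0.
Proof. by move=> h; apply/eqP; rewrite -normr_eq0 rnormE h. Qed.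

Lemma rnorm_gt0 (V : normedZmodType R[i]) (x : V) : (0 < rnorm x) = (x != 0).
Proof.
rewrite lt0r rnorm_ge0 andbT; congr negb; apply/eqP/eqP; first exact: rnorm_eq0.
by move=> ->; exact: rnorm0.
Qed.

Lemma rnormM (a b : R[i]) : rnorm (a * b) = rnorm a * rnorm b.
Proof. by apply: (@complexI R); rewrite rmorphM /= -!rnormE normrM. Qed.

Lemma rnormZ (X : normedModType R[i]) (a : R[i]) (x : X) :
  rnorm (a *: x) = rnorm a * rnorm x.
Proof. by apply: (@complexI R); rewrite rmorphM /= -!rnormE normrZ. Qed.

Lemma rnorm_real (r : R) : rnorm (r%:C)%C = `|r|.
Proof. by rewrite /rnorm normc_def /= expr0n addr0 sqrtr_sqr. Qed.

Lemma rnorm1 : rnorm (1 : R[i]) = 1.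
Proof. by rewrite /rnorm normr1. Qed.

Lemma rnormV (a : R[i]) : rnorm a^-1 = (rnorm a)^-1.
Proof.
have [->|a0] := eqVneq a 0; first by rewrite invr0 rnorm0 invr0.
have na0 : rnorm a != 0 by rewrite gt_eqF // rnorm_gt0.
by apply: (mulfI na0); rewrite -rnormM !mulfV // rnorm1.
Qed.

Lemma rnorm_eps0 (V : normedZmodType R[i]) (x : V) :
  (forall e, 0 < e -> rnorm x < e) -> x = 0.
Proof.
move=> h; apply: rnorm_eq0; apply/eqP; rewrite eq_le rnorm_ge0 andbT.
by rewrite leNgt; apply/negP => /h; rewrite ltxx.
Qed.

Lemma nbhs_rnormP (X : pseudoMetricNormedZmodType R[i]) (x : X) (A : set X) :
  nbhs x A <-> exists2 e : R, 0 < e & forall y, rnorm (x - y) < e -> A y.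
Proof.
split=> [/nbhs_normP[e /= e0 h]|[e e0 h]].
  have eE : e = ((complex.Re e)%:C)%C by rewrite RRe_real // gtr0_real.
  exists (complex.Re e); first by move: e0; rewrite eE ltcR.
  by move=> y xy; apply: h; rewrite /ball_ /= rnormE eE ltcR.
apply/nbhs_normP; exists ((e%:C)%C); first by rewrite /= ltcR.
by move=> y; rewrite /ball_ /= rnormE ltcR; exact: h.
Qed.

Lemma closed_rnormP (X : pseudoMetricNormedZmodType R[i]) (A : set X) :
  closed A <->
  forall x, (forall e, 0 < e -> exists2 y, A y & rnorm (x - y) < e) -> A x.
Proof.
split=> [cA x hx|h x clx].
  apply: cA => B /nbhs_rnormP[e e0 hB].
  by have [y Ay xy] := hx _ e0; exists y; split=> //; exact: hB.
apply: h => e e0; have [|y []] := clx [set y | rnorm (x - y) < e].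
  by apply/nbhs_rnormP; exists e.
by exists y.
Qed.

Lemma complete_modulus (X : completeNormedModType R[i]) (u : nat -> X)
    (e : nat -> R) :
  (forall n m, (n <= m)%N -> rnorm (u m - u n) <= e n) ->
  (forall d, 0 < d -> exists n, e n < d) ->
  exists l, forall n, rnorm (l - u n) <= e n.
Proof.
move=> hu he.
have /cauchy_cvgP/cvg_ex[l ul] : cauchy (u @ \oo).
  apply/cauchy_ballP => d d0.
  have dE : d = ((complex.Re d)%:C)%C by rewrite RRe_real // gtr0_real.
  have d'0 : 0 < complex.Re d / 2 by rewrite divr_gt0 //; move: d0; rewrite dE ltcR.
  have [n en] := he _ d'0.
  exists ([set u m | m in [set m | (n <= m)%N]],
          [set u m | m in [set m | (n <= m)%N]]) => /=.
    by split; exists n => // m nm /=; exists m.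
  move=> [x y] /= [[p np <-] [q nq <-]].
  rewrite -ball_normE /ball_ /= rnormE dE ltcR.
  apply: (le_lt_trans (rnorm_triangle (u n) _ _)).
  rewrite (rnorm_distC (u n)).
  by have := hu _ _ np; have := hu _ _ nq; lra.
exists l => n; apply/ler_addgt0Pr => d d0.
have : nbhs l [set y | rnorm (l - y) < d] by apply/nbhs_rnormP; exists d.
move=> /ul [k _ hk].
have := hk (maxn k n) (leq_maxl _ _); rewrite /= => h1.
have := hu n (maxn k n) (leq_maxr _ _) => h2.
by apply: (le_trans (rnorm_triangle (u (maxn k n)) _ _)); lra.
Qed.

Lemma rnorm_le_ReIm (a : R[i]) :
  rnorm a <= `|complex.Re a| + `|complex.Im a|.
Proof.
rewrite {1}(complexE a); apply: (le_trans (rnormD _ _)).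
rewrite rnormM !rnorm_real (_ : rnorm _ = 1) ?mul1r //.
by rewrite /rnorm normc_def /= expr0n expr1n add0r sqrtr1.
Qed.

Lemma Re_le_rnorm (a : R[i]) : `|complex.Re a| <= rnorm a.
Proof. by have := normc_ge_Re a; rewrite rnormE lecR. Qed.

Lemma Im_le_rnorm (a : R[i]) : `|complex.Im a| <= rnorm a.
Proof.
rewrite /rnorm normc_def /= -sqrtr_sqr ler_sqrt ?addr_ge0 ?sqr_ge0 //.
by rewrite lerDr sqr_ge0.
Qed.

(** Every left endpoint [u m - e m] lies below every right endpoint [u n + e n], so the supremum of
    the left endpoints lies in all the intervals at once. *)
Lemma complete_modulus_real (u e : nat -> R) :
  (forall n m, (n <= m)%N -> `|u m - u n| <= e n) ->
  exists l, forall n, `|l - u n| <= e n.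
Proof.
move=> hu; pose E := range (fun n => u n - e n).
have ub n : ubound E (u n + e n).
  move=> _ [m _ <-]; case: (leqP m n) => mn.
    by have := hu _ _ mn; have := hu _ _ (leqnn n); rewrite !ler_norml; lra.
  by have := hu _ _ (ltnW mn); have := hu _ _ (leqnn m); rewrite !ler_norml; lra.
have E0 : E !=set0 by exists (u 0%N - e 0%N), 0%N.
have hsE : has_sup E by split=> //; exists (u 0%N + e 0%N).
exists (sup E) => n; rewrite ler_norml; apply/andP; split.
  have /(sup_upper_bound hsE) : E (u n - e n) by exists n.
  lra.
have := ge_sup E0 (ub n); lra.
Qed.

Lemma complete_modulus_complex (u : nat -> R[i]) (e : nat -> R) :
  (forall n m, (n <= m)%N -> rnorm (u m - u n) <= e n) ->
  exists l, forall n, rnorm (l - u n) <= 2 * e n.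
Proof.
move=> hu.
have [a ha] : exists a, forall n, `|a - complex.Re (u n)| <= e n.
  apply: complete_modulus_real => n m nm; apply: le_trans (hu _ _ nm).
  by rewrite -raddfB; exact: Re_le_rnorm.
have [b hb] : exists a, forall n, `|a - complex.Im (u n)| <= e n.
  apply: complete_modulus_real => n m nm; apply: le_trans (hu _ _ nm).
  by rewrite -raddfB; exact: Im_le_rnorm.
exists (Complex a b) => n; apply: (le_trans (rnorm_le_ReIm _)).
have := ha n; have := hb n; case: (u n) => c d /=; lra.
Qed.

End RealNorm.

(** * Bounded operators: successive approximation, Baire category, open mapping *)

Section BoundedOperators.
Context {R : realType} {X : completeNormedModType R[i]}.
Implicit Types (L S : X -> X) (A M Y Z : set X).

Definition bounded_op L : Prop :=
  (forall a x y, L (a *: x + y) = a *: L x + L y) /\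
  exists2 B : R, 0 <= B & forall x, rnorm (L x) <= B * rnorm x.

Lemma bounded_opD L x y : bounded_op L -> L (x + y) = L x + L y.
Proof. by case=> lL _; have := lL 1 x y; rewrite !scale1r. Qed.

Lemma bounded_op0 L : bounded_op L -> L 0 = 0.
Proof.
move=> bL; have /eqP := bounded_opD 0 0 bL.
by rewrite addr0 -[X in X == _]addr0 (inj_eq (addrI _)) eq_sym => /eqP.
Qed.

Lemma bounded_opZ L a x : bounded_op L -> L (a *: x) = a *: L x.
Proof. by move=> bL; have := bL.1 a x 0; rewrite (bounded_op0 bL) !addr0. Qed.

Lemma bounded_opN L x : bounded_op L -> L (- x) = - L x.
Proof. by move=> bL; rewrite -scaleN1r (bounded_opZ _ _ bL) scaleN1r. Qed.

Lemma bounded_opB L x y : bounded_op L -> L (x - y) = L x - L y.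
Proof. by move=> bL; rewrite (bounded_opD _ _ bL) (bounded_opN _ bL). Qed.

Lemma bounded_op_shift L l : bounded_op L -> bounded_op (shift L l).
Proof.
move=> [lL [B B0 hB]]; split.
  move=> a x y; rewrite /shift lL scalerDr scalerBr !scalerA (mulrC l) -!scalerA.
  by rewrite opprD addrACA.
exists (B + rnorm l); first by rewrite addr_ge0 // rnorm_ge0.
move=> x; rewrite /shift mulrDl -rnormZ.
by apply: (le_trans (rnormB _ _)); rewrite lerD2r.
Qed.

Lemma bounded_op_iter L n : bounded_op L -> bounded_op (iter n L).
Proof.
move=> bL; elim: n => [|n [lI [B B0 hB]]].
  by split=> // ; exists 1 => // x /=; rewrite mul1r.
have [lL [B' B'0 hB']] := bL; split.
  by move=> a x y /=; rewrite lI lL.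
exists (B' * B); first exact: mulr_ge0.
move=> x /=; apply: (le_trans (hB' _)); rewrite -mulrA.
exact: ler_wpM2l.
Qed.

Lemma subspaceD A x y : subspace A -> A x -> A y -> A (x + y).
Proof. by move=> [_ h] Ax Ay; have := h 1 _ _ Ax Ay; rewrite scale1r. Qed.

Lemma subspaceZ A a x : subspace A -> A x -> A (a *: x).
Proof. by move=> [A0 h] Ax; have := h a _ _ Ax A0; rewrite addr0. Qed.

Lemma subspaceN A x : subspace A -> A x -> A (- x).
Proof. by move=> sA Ax; rewrite -scaleN1r; exact: subspaceZ. Qed.

Lemma subspaceB A x y : subspace A -> A x -> A y -> A (x - y).
Proof. by move=> sA Ax Ay; apply: subspaceD => //; exact: subspaceN. Qed.

Lemma subspace_image L A : bounded_op L -> subspace A -> subspace (L @` A).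
Proof.
move=> bL sA; split; first by exists 0; [exact: sA.1|exact: bounded_op0].
move=> a _ _ [x Ax <-] [y Ay <-]; exists (a *: x + y); first exact: sA.2.
exact: bL.1.
Qed.

Lemma subspace_setI A M : subspace A -> subspace M -> subspace (A `&` M).
Proof.
move=> sA sM; split; first by split; [exact: sA.1|exact: sM.1].
by move=> a x y [Ax Mx] [Ay My]; split; [exact: sA.2|exact: sM.2].
Qed.

Lemma geometric_small (C q d : R) : 0 <= q < 1 -> 0 < d ->
  exists n, C * q ^+ n < d.
Proof.
move=> /andP[q0 q1] d0.
have /cvgrPdist_lt /(_ _ d0) [n _ hn] : (geometric C q) @ \oo --> (0 : R).
  by apply: cvg_geometric; rewrite ger0_norm.
exists n; have := hn n (leqnn n); rewrite sub0r normrN /=.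
exact: le_lt_trans (ler_norm _).
Qed.

(* Iterate the approximate inverse on the remainders [r k] of [y]. *)
Lemma approximate_solution L Y Z (C q : R) :
  bounded_op L -> closed Y -> subspace Y -> 0 <= C -> 0 <= q < 1 ->
  (forall y, Z y -> exists x, [/\ Y x, rnorm x <= C * rnorm y, Z (y - L x)
    & rnorm (y - L x) <= q * rnorm y]) ->
  forall y, Z y -> exists x, [/\ Y x, L x = y
    & rnorm x <= C / (1 - q) * rnorm y].
Proof.
move=> bL cY sY C0 q01 h y Zy.
have step z : exists x, Z z -> [/\ Y x,
    rnorm x <= C * rnorm z, Z (z - L x) & rnorm (z - L x) <= q * rnorm z].
  by have [Zz|nZz] := pselect (Z z); [have [x] := h _ Zz; exists x|exists 0].
have [f hf] := choice step.
pose r := fix r k := if k is k'.+1 then r k' - L (f (r k')) else y.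
pose s k := \sum_(i < k) f (r i).
have /andP[q0 q1] := q01.
have Zr k : Z (r k) by elim: k => //= k /hf[].
have rq k : rnorm (r k) <= q ^+ k * rnorm y.
  elim: k => [|k IH]; first by rewrite expr0 mul1r.
  have [_ _ _] := hf _ (Zr k); rewrite -/(r k.+1) => /le_trans; apply.
  by rewrite exprS -mulrA ler_wpM2l.
have Ys k : Y (s k).
  elim: k => [|k IH]; first by rewrite /s big_ord0; exact: sY.1.
  by rewrite /s big_ord_recr; apply: subspaceD => //; case: (hf _ (Zr k)).
have Ls k : y - L (s k) = r k.
  elim: k => [|k IH]; first by rewrite /s big_ord0 bounded_op0 // subr0.
  by rewrite /s big_ord_recr /= bounded_opD // opprD addrA -/(s k) IH.
pose D := C * rnorm y / (1 - q).
have q1' : 0 < 1 - q by lra.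
have D0 : 0 <= D by rewrite /D !mulr_ge0 ?rnorm_ge0 // invr_ge0 ltW.
(* [D] is the sum of the geometric series. The k-th term is at most [D * (q ^+ k - q ^+ k.+1)], so
   the bound telescopes. *)
have sD n k : rnorm (s (k + n)%N - s n) <= D * (q ^+ n - q ^+ (k + n)).
  elim: k => [|k IH]; first by rewrite add0n !subrr rnorm0 mulr0.
  rewrite addSn {1}/s big_ord_recr /= -/(s (k + n)%N) addrAC.
  apply: (le_trans (rnormD _ _)).
  have [_ fC _ _] := hf _ (Zr (k + n)%N).
  have h1 : C * rnorm (r (k + n)%N) <= C * (q ^+ (k + n) * rnorm y).
    exact: ler_wpM2l.
  have h2 : C * (q ^+ (k + n) * rnorm y) = D * (q ^+ (k + n) - q ^+ (k + n).+1).
    by rewrite /D exprS; field; rewrite gt_eqF.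
  rewrite h2 in h1; move: IH fC h1; rewrite !mulrBr; lra.
have sD' n m : (n <= m)%N -> rnorm (s m - s n) <= D * q ^+ n.
  move=> nm; have := sD n (m - n)%N; rewrite subnK // => /le_trans; apply.
  by apply: ler_wpM2l => //; rewrite gerBl exprn_ge0.
have [l hl] : exists l, forall n, rnorm (l - s n) <= D * q ^+ n.
  by apply: complete_modulus => // d d0; exact: geometric_small.
exists l; split.
- move/closed_rnormP: cY; apply => e e0.
  have [n hn] := geometric_small D q01 e0.
  by exists (s n) => //; exact: le_lt_trans hn.
- apply/eqP; rewrite eq_sym -subr_eq0; apply/eqP/rnorm_eps0 => e e0.
  have [B B0 hB] := bL.2.
  have [n hn] := geometric_small (rnorm y + B * D) q01 e0.
  apply: le_lt_trans hn; apply: (le_trans (rnorm_triangle (L (s n)) _ _)).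
  rewrite Ls -bounded_opB // mulrDl lerD //; first by rewrite mulrC.
  by apply: (le_trans (hB _)); rewrite rnorm_distC -mulrA ler_wpM2l.
- have := hl 0%N; rewrite /s big_ord0 subr0 expr0 mulr1 => /le_trans; apply.
  by rewrite /D mulrAC.
Qed.

(** Baire's theorem, with density of [F n] in a ball of [Z] in place of interior points of closures.
    If it failed, nested balls avoiding [F 0], [F 1], ... would shrink to a point of [Z] outside
    every [F n]. *)
Lemma baire_closed Z (F : nat -> set X) :
  closed Z -> Z !=set0 -> (forall z, Z z -> exists n, F n z) ->
  exists n z, exists r : R, [/\ Z z, 0 < r & forall y, Z y -> rnorm (z - y) < r ->
    forall e, 0 < e -> exists2 w, F n w & rnorm (y - w) < e].
Proof.
move=> cZ [z0 Zz0] ZF; apply: contrapT => hn.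
(* [a] packs the stage, the centre and the radius. Halving sends the radii to 0, the bound on the
   sum nests the balls, and the last clause keeps even the closed new ball off [F a.1]. *)
have step (a : nat * (X * R)) : exists p : X * R, Z a.2.1 -> 0 < a.2.2 ->
    [/\ Z p.1, 0 < p.2, p.2 <= a.2.2 / 2, rnorm (p.1 - a.2.1) + p.2 <= a.2.2 &
     forall w, F a.1 w -> p.2 < rnorm (p.1 - w)].
  case: a => n [z r] /=.
  have [Zz|nZ] := pselect (Z z); last by exists (z, r).
  have [r0|nr] := pselect (0 < r); last by exists (z, r).
  apply: contrapT => hp; apply: hn; exists n, z, r; split=> // y Zy zy e e0.
  apply: contrapT => hw; apply: hp.
  pose d := r - rnorm (z - y).
  have d0 : 0 < d by rewrite subr_gt0.
  exists (y, Num.min (Num.min (r / 2) d) (e / 2)) => _ _ /=; split => //.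
  - by rewrite !lt_min; apply/andP; split; [apply/andP; split|]; lra.
  - by rewrite !ge_min lexx.
  - have : Num.min (Num.min (r / 2) d) (e / 2) <= d by rewrite !ge_min lexx orbT.
    rewrite rnorm_distC /d; lra.
  - move=> w Fw; rewrite ltNge; apply/negP => hm; apply: hw; exists w => //.
    apply: (le_lt_trans hm); rewrite gt_min; apply/orP; right; lra.
have [f hf] := choice step.
pose s := fix s n := if n is n'.+1 then f (n', s n') else (z0, 1 : R).
have inv n : Z (s n).1 /\ 0 < (s n).2.
  by elim: n => //= n [h1 h2]; have [] := hf (n, s n) h1 h2.
have hs n := hf (n, s n) (inv n).1 (inv n).2.
have s2 n : (s n).2 <= 2^-1 ^+ n.
  elim: n => //= n IH; have [_ _ + _ _] := hs n; rewrite /= exprS; lra.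
have sD n k : rnorm ((s (k + n)%N).1 - (s n).1) + (s (k + n)%N).2 <= (s n).2.
  elim: k => [|k IH]; first by rewrite add0n subrr rnorm0 add0r.
  have [_ _ _ + _] := hs (k + n)%N; rewrite addSn [s (k + n).+1]/=.
  have := rnorm_triangle (s (k + n)%N).1 (f ((k + n)%N, s (k + n)%N)).1 (s n).1.
  rewrite /=; lra.
have q01 : 0 <= (2^-1 : R) < 1 by lra.
have small d : 0 < d -> exists n, (s n).2 < d.
  move=> d0; have [n] := geometric_small 1 q01 d0.
  by rewrite mul1r => hn'; exists n; exact: le_lt_trans hn'.
have [l hl] : exists l, forall n, rnorm (l - (s n).1) <= (s n).2.
  apply: (@complete_modulus _ _ (fun n => (s n).1) (fun n => (s n).2)) => // n m nm.
  have := sD n (m - n)%N; rewrite subnK //.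
  by have := (inv m).2; lra.
have Zl : Z l.
  move/closed_rnormP: cZ; apply => e /small[n hn'].
  by exists (s n).1; [exact: (inv n).1|exact: le_lt_trans hn'].
have [n Fl] := ZF _ Zl; have [_ _ _ _ /(_ _ Fl)] := hs n.
by have := hl n.+1; rewrite /= rnorm_distC; lra.
Qed.

(** Baire's theorem applies on the closed range, which is covered by the images of the balls of [M]
    with integer radius. Injectivity is not assumed, so the estimate concerns one chosen
    preimage. *)
Lemma open_mapping L M :
  bounded_op L -> subspace M -> closed M -> closed (L @` M) ->
  exists2 C : R, 0 < C & forall y, (L @` M) y ->
    exists x, [/\ M x, L x = y & rnorm x <= C * rnorm y].
Proof.
move=> bL sM cM cZ; set Z := L @` M.
have sZ : subspace Z by exact: subspace_image.
have [||n [z [r [Zz r0 hr]]]] :=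
  @baire_closed Z (fun n => L @` [set x | M x /\ rnorm x < n%:R]) cZ.
- by exists 0; exact: sZ.1.
- move=> _ [x Mx <-]; exists (Num.bound (rnorm x)), x => //; split=> //.
  by have := archi_boundP (rnorm_ge0 x).
(* Subtracting approximate preimages of [z] from those of [z + y] recentres the ball at 0 and
   doubles the bound on the preimages. *)
have hZ y : Z y -> rnorm y < r -> forall e, 0 < e ->
    exists x, [/\ M x, rnorm x <= 2 * n%:R & rnorm (y - L x) < e].
  move=> Zy yr e e0; have e20 : 0 < e / 2 by lra.
  have [|w1 [x1 [Mx1 x1n] <-] h1] := hr (z + y) (subspaceD sZ Zz Zy) _ _ e20.
    by rewrite opprD addrA subrr sub0r rnormN.
  have [|w2 [x2 [Mx2 x2n] <-] h2] := hr z Zz _ _ e20.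
    by rewrite subrr rnorm0.
  exists (x1 - x2); split; first exact: subspaceB.
    by apply: (le_trans (rnormB _ _)); lra.
  rewrite bounded_opB // (_ : _ - _ = (z + y - L x1) - (z - L x2)).
    by apply: (le_lt_trans (rnormB _ _)); lra.
  by rewrite [RHS]addrC !opprB !addrA subrK [b in b - _ = _]addrC.
(* A nonzero [y] is rescaled to norm [r / 2] and approximated up to [r / 4], which is half its norm;
   scaling the preimage bound [2 * n%:R] back gives [C]. *)
pose C := 4 * n%:R / r.
have C0 : 0 <= C by rewrite /C divr_ge0 ?mulr_ge0 ?ler0n // ltW.
have half : (1 - 2^-1 : R)^-1 = 2 by field.
(* The factor 2 sums the geometric series of ratio [2^-1]; the added 1 keeps the constant positive
   when [n] is 0. *)
exists (C * 2 + 1); first by clearbody C; lra.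
move=> y Zy.
have [||x [Mx Lx xC]] := @approximate_solution L M Z C 2^-1 bL cM sM C0 _ _ y Zy.
- lra.
- move=> {y Zy} y Zy; have [y0|/eqP y0] := eqVneq (rnorm y) 0.
    exists 0; rewrite bounded_op0 // subr0 rnorm0 y0 !mulr0; split=> //.
    exact: sM.1.
  have {}y0 : 0 < rnorm y by rewrite lt0r rnorm_ge0 andbT; apply/eqP.
  pose t := r / (2 * rnorm y); have t0 : 0 < t by rewrite divr_gt0 //; lra.
  pose tc : R[i] := (t%:C)%C.
  have tc0 : tc != 0 by apply/eqP => /complexI /eqP; rewrite gt_eqF.
  have nt : rnorm tc = t by rewrite rnorm_real gtr0_norm.
  have nti : rnorm tc^-1 = t^-1. by rewrite rnormV nt.
  have ty : t * rnorm y = r / 2 by rewrite /t; field; rewrite gt_eqF.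
  have [|||x [Mx xn xe]] := hZ (tc *: y) _ _ (r / 4).
  - exact: subspaceZ.
  - by rewrite rnormZ nt ty; lra.
  - lra.
  exists (tc^-1 *: x).
  have E : y - L (tc^-1 *: x) = tc^-1 *: (tc *: y - L x).
    by rewrite scalerBr scalerA mulVf // scale1r bounded_opZ.
  rewrite E !rnormZ nti; split.
  + exact: subspaceZ.
  + apply: (@le_trans _ _ (t^-1 * (2 * n%:R))).
      by apply: ler_wpM2l => //; rewrite invr_ge0 ltW.
    by rewrite le_eqVlt; apply/orP; left; apply/eqP; rewrite /t /C; field; rewrite !gt_eqF.
  + by rewrite -E; apply: subspaceB => //; exists (tc^-1 *: x) => //; exact: subspaceZ.
  + apply: (@le_trans _ _ (t^-1 * (r / 4))).
      by apply: ler_wpM2l; [rewrite invr_ge0 ltW|exact: ltW].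
    by rewrite le_eqVlt; apply/orP; left; apply/eqP; rewrite /t; field; rewrite !gt_eqF.
exists x; split=> //; apply: (le_trans xC); rewrite half mulrDl mul1r lerDl.
exact: rnorm_ge0.
Qed.

End BoundedOperators.

(** * Perturbation of bijectivity and of Kato operators *)

Section Perturbation.
Context {R : realType} {X : completeNormedModType R[i]}.
Implicit Types (A S : X -> X) (E M N W Y Z : set X).

(** For linear [S] and an invariant subspace [Y], this is bijectivity of the restriction; invariance
    is kept as a separate hypothesis. *)
Definition bij_on S Y : Prop :=
  (forall x, Y x -> S x = 0 -> x = 0) /\
  (forall y, Y y -> exists2 x, Y x & S x = y).

Definition arbitrarily_small (P : R[i] -> Prop) : Prop :=
  forall e : R, 0 < e -> exists2 v, rnorm v < e & P v.

Lemma invariant_iter S Y n x : invariant S Y -> Y x -> Y (iter n S x).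
Proof. by move=> iS Yx; elim: n => //= n IH; apply: iS; exists (iter n S x). Qed.

Lemma invariant_shift S Y l : subspace Y -> invariant S Y ->
  invariant (shift S l) Y.
Proof.
move=> sY iS _ [x Yx <-]; apply: subspaceB => //; last exact: subspaceZ.
by apply: iS; exists x.
Qed.

Lemma image_bij_on S Y : invariant S Y -> bij_on S Y -> S @` Y = Y.
Proof. by move=> iS [_ sS]; apply/seteqP; split=> // y /sS[x]; exists x. Qed.

Lemma bounded_below S Y : bounded_op S -> subspace Y -> closed Y ->
  closed (S @` Y) -> (forall x, Y x -> S x = 0 -> x = 0) ->
  exists2 C : R, 0 < C & forall x, Y x -> rnorm x <= C * rnorm (S x).
Proof.
move=> bS sY cY cR inj.
have [C C0 hC] := open_mapping bS sY cY cR.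
exists C => // x Yx; have [|x' [Yx' Sx' x'C]] := hC (S x); first by exists x.
suff xx' : x - x' = 0 by rewrite {1}(subr0_eq xx').
by apply: inj; [exact: subspaceB|rewrite bounded_opB // Sx' subrr].
Qed.

(** Preimages under [S - v0] serve as approximate preimages under [S - v]. The lower bound of [S]
    controls their size independently of [v0], so the error [(v - v0) *: x] is a contraction. *)
Lemma bij_on_perturbation S Y (C : R) v0 v :
  bounded_op S -> subspace Y -> closed Y -> 0 < C ->
  (forall x, Y x -> rnorm x <= C * rnorm (S x)) ->
  C * rnorm v0 <= 4^-1 -> bij_on (shift S v0) Y ->
  C * rnorm v <= 4^-1 -> bij_on (shift S v) Y.
Proof.
move=> bS sY cY C0 below Cv0 [_ surj0] Cv.
have below' w x : C * rnorm w <= 4^-1 -> Y x ->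
    rnorm x <= 4 / 3 * C * rnorm (shift S w x).
  move=> Cw Yx; have := below _ Yx.
  have : rnorm (S x) <= rnorm (shift S w x) + rnorm w * rnorm x.
    by rewrite -rnormZ; apply: le_trans (rnormD _ _); rewrite /shift subrK.
  move=> /(ler_wpM2l (ltW C0)).
  have := ler_wpM2r (rnorm_ge0 x) Cw.
  by rewrite mulrDr mulrA -[4 / 3 * C * _]mulrA; lra.
split=> [x Yx Sx|y Yy].
  apply: rnorm_eq0; apply/eqP; rewrite eq_le rnorm_ge0 andbT.
  by have := below' _ _ Cv Yx; rewrite Sx rnorm0 mulr0.
(* Here [4 / 3] is [1 / (1 - 4^-1)], and [2 / 3] is [4 / 3 * (4^-1 + 4^-1)]. *)
have [|||x [Yx Sx _]] := @approximate_solution _ _ (shift S v) Y Y (4 / 3 * C)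
    (2 / 3) (bounded_op_shift v bS) cY sY _ _ _ y Yy.
- by rewrite !mulr_ge0 ?invr_ge0 // ltW.
- lra.
- move=> {y Yy} y Yy; have [x Yx Sx] := surj0 _ Yy; exists x.
  have xC := below' _ _ Cv0 Yx; rewrite Sx in xC.
  have E : y - shift S v x = (v - v0) *: x.
    by rewrite -Sx /shift opprB addrC addrA subrK scalerBl.
  rewrite E; split=> //; first exact: subspaceZ.
  rewrite rnormZ; apply: (le_trans (ler_wpM2r (rnorm_ge0 x) (rnormB _ _))).
  have h : rnorm v + rnorm v0 <= 2^-1 / C.
    by rewrite ler_pdivlMr // mulrDl ![_ * C]mulrC; lra.
  apply: (le_trans (ler_wpM2r (rnorm_ge0 x) h)).
  have h' : 0 <= 2^-1 / C by rewrite divr_ge0 // ltW.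
  apply: (le_trans (ler_wpM2l h' xC)).
  by rewrite le_eqVlt; apply/orP; left; apply/eqP; field; rewrite gt_eqF.
by exists x.
Qed.

(* A kernel vector [x0] extends to a backward orbit [x k] of geometric growth,
   so that [u n = \sum_(k <= n) v ^+ k *: x k] is nearly in the kernel of
   [S - v] although it stays close to [x0]. *)
Lemma Kato_injective S Y :
  bounded_op S -> subspace Y -> closed Y -> invariant S Y -> Kato_on S Y ->
  arbitrarily_small (fun v => bij_on (shift S v) Y) ->
  forall x, Y x -> S x = 0 -> x = 0.
Proof.
move=> bS sY cY iY [cR Kato] small x0 Yx0 Sx0.
have [C C0 hC] := open_mapping bS sY cY cR.
pose core y := forall n, (iter n S @` Y) y.
have coreY y : core y -> Y y by move=> /(_ 0%N)[z Yz <-].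
(* Every preimage in [Y] of a core point is again in the core: it differs from a preimage
   [iter n S z] by a kernel vector, which the Kato condition puts in the range of [iter n S]. Hence
   the preimage with the norm bound will do. *)
have step y : exists x, core y -> [/\ core x, S x = y & rnorm x <= C * rnorm y].
  have [cy|] := pselect (core y); last by exists 0.
  have [x [Yx Sx xC]] := hC _ (cy 1%N); exists x => _; split=> // n.
  have [z Yz zy] := cy n.+1.
  have Yw : Y (iter n S z) by exact: invariant_iter.
  have : ker_on S Y (x - iter n S z).
    by split; [exact: subspaceB|rewrite /= bounded_opB // Sx -zy /= subrr].
  move=> /(Kato n) h.
  have sI := subspace_image (bounded_op_iter n bS) sY.
  have Iz : (iter n S @` Y) (iter n S z) by exists z.
  by have := subspaceD sI h Iz; rewrite subrK.
have [f hf] := choice step.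
pose xs k := iter k f x0.
have core_xs k : core (xs k).
  by elim: k => [n|k IH]; [exact: (Kato n x0)|case: (hf _ IH)].
have xsC k : rnorm (xs k) <= C ^+ k * rnorm x0.
  elim: k => [|k IH]; first by rewrite expr0 mul1r.
  have [_ _ h] := hf _ (core_xs k); apply: (le_trans h).
  by rewrite exprS -mulrA; apply: ler_wpM2l => //; exact: ltW.
(* With this bound the terms of [u n] decay like [4^-1 ^+ k]; those with positive index add up to at
   most a third of [rnorm x0]. *)
have [v vC bv] : exists2 v, rnorm v < (4 * C)^-1 & bij_on (shift S v) Y.
  by apply: small; rewrite invr_gt0; lra.
have {}vC : rnorm v * C <= 4^-1.
  move: vC; rewrite invfM -ler_pdivlMr //; exact: ltW.
have bSv := bounded_op_shift v bS.
(* [D] depends on [v] without any control. This is harmless: [v] is fixed from here on, and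
   [shift S v (u n)] tends to 0 as [n] grows. *)
have [D D0 hD] : exists2 D : R, 0 < D &
    forall x, Y x -> rnorm x <= D * rnorm (shift S v x).
  apply: bounded_below => //; last exact: bv.1.
  by rewrite image_bij_on //; exact: invariant_shift.
have vxs k : rnorm (v ^+ k *: xs k) <= 4^-1 ^+ k * rnorm x0.
  have rX : rnorm (v ^+ k) = rnorm v ^+ k.
    by elim: k => [|k IH]; rewrite ?expr0 ?rnorm1 // !exprS rnormM IH.
  rewrite rnormZ rX; apply: (@le_trans _ _ ((rnorm v * C) ^+ k * rnorm x0)).
    by rewrite exprMn -mulrA; apply: ler_wpM2l => //; rewrite exprn_ge0 ?rnorm_ge0.
  apply: ler_wpM2r; first exact: rnorm_ge0.
  by rewrite lerXn2r // nnegrE // mulr_ge0 ?rnorm_ge0 // ltW.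
pose u n := \sum_(k < n.+1) v ^+ k *: xs k.
have Yu n : Y (u n).
  elim: n => [|n IH]; rewrite /u big_ord_recr /=.
    by rewrite big_ord0 add0r scale1r.
  apply: subspaceD => //; apply: subspaceZ => //.
  exact: coreY (core_xs n.+1).
have Su n : shift S v (u n) = - (v ^+ n.+1 *: xs n).
  elim: n => [|n IH]; rewrite /u big_ord_recr /=.
    by rewrite big_ord0 add0r scale1r /shift Sx0 sub0r expr1.
  rewrite (bounded_opD _ _ bSv) -/(u n) IH (bounded_opZ _ _ bSv) /shift.
  have [_ -> _] := hf _ (core_xs n).
  by rewrite scalerBr scalerA -exprSr addrA addNr sub0r.
have ux n : rnorm (u n - x0) <= 3^-1 * (1 - 4^-1 ^+ n) * rnorm x0.
  elim: n => [|n IH].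
    by rewrite /u big_ord_recr big_ord0 /= add0r scale1r !subrr rnorm0 mulr0 mul0r.
  rewrite /u big_ord_recr /= -/(u n) addrAC; apply: (le_trans (rnormD _ _)).
  have := vxs n.+1; move: IH; rewrite [4^-1 ^+ n.+1]exprS.
  set a := 4^-1 ^+ n; lra.
apply/eqP/negPn/negP => x00.
have nx0 : 0 < rnorm x0 by rewrite rnorm_gt0.
have q01 : 0 <= (4^-1 : R) < 1 by lra.
have d0 : 0 < 2 / 3 * rnorm x0 by lra.
have [n hn] := geometric_small (D * rnorm v * rnorm x0) q01 d0.
have h1 := hD _ (Yu n); rewrite Su rnormN exprS -scalerA rnormZ in h1.
have h2 : D * (rnorm v * rnorm (v ^+ n *: xs n)) <=
    D * rnorm v * rnorm x0 * 4^-1 ^+ n.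
  rewrite mulrA -[X in _ <= X]mulrA [rnorm x0 * _]mulrC.
  by apply: ler_wpM2l; rewrite // mulr_ge0 ?rnorm_ge0 // ltW.
have h3 : rnorm x0 <= rnorm (u n) + rnorm (u n - x0).
  have := rnormB (u n) (u n - x0); by rewrite subKr.
have h4 : 0 <= 4^-1 ^+ n * rnorm x0 by rewrite mulr_ge0 ?exprn_ge0 // ltW.
have := ux n; lra.
Qed.

Lemma Kato_bij_near S Y :
  bounded_op S -> subspace Y -> closed Y -> invariant S Y -> Kato_on S Y ->
  arbitrarily_small (fun v => bij_on (shift S v) Y) ->
  exists2 d : R, 0 < d & forall v, rnorm v < d -> bij_on (shift S v) Y.
Proof.
move=> bS sY cY iY KY small; have inj := Kato_injective bS sY cY iY KY small.
have [C C0 hC] := bounded_below bS sY cY KY.1 inj.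
have d0 : 0 < 4^-1 / C by rewrite divr_gt0.
have [v0 v0d bv0] := small _ d0.
exists (4^-1 / C) => // v vd.
apply: (bij_on_perturbation bS sY cY C0 hC _ bv0).
  by rewrite mulrC -ler_pdivlMr // ltW.
by rewrite mulrC -ler_pdivlMr // ltW.
Qed.

End Perturbation.

(** * Finite-dimensional subspaces and closedness of sums and images *)

Section FiniteDimension.
Context {R : realType} {X : completeNormedModType R[i]}.
Implicit Types (S : X -> X) (E M N W Y Z : set X) (s : seq X) (v x e : X).

Lemma subspace_span s : subspace (span s : set X).
Proof.
split; first by exists (fun=> 0); rewrite big1 // => i _; rewrite scale0r.
move=> a _ _ [c ->] [d ->]; exists (fun i => a * c i + d i).
rewrite scaler_sumr -big_split; apply: eq_bigr => i _.
by rewrite scalerDl scalerA.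
Qed.

Lemma span_nil x : span ([::] : seq X) x -> x = 0.
Proof. by case=> c ->; rewrite big_ord0. Qed.

Lemma span_consP v s x :
  span (v :: s) x <-> exists a w, span s w /\ x = a *: v + w.
Proof.
split=> [[c ->]|[a [w [[c ->] ->]]]].
  exists (c ord0), (\sum_(i < size s) c (lift ord0 i) *: s`_i).
  split; last by rewrite big_ord_recl.
  by exists (fun i => c (lift ord0 i)).
exists (fun i : 'I_(size s).+1 => if unlift ord0 i is Some j then c j else a).
rewrite /= big_ord_recl unlift_none; congr (_ + _).
by apply: eq_bigr => i _; rewrite liftK.
Qed.

(** Steinitz exchange: outside [span s], the vector [e] has a nonzero coefficient at [v] and can
    take its place. *)
Lemma span_cons_exchange E v s e x : subspace E -> E `<=` span (v :: s) ->
  E e -> ~ span s e -> E x -> exists a, span s (x - a *: e).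
Proof.
move=> sE hE Ee ne Ex.
have /span_consP[a [w [sw ew]]] := hE _ Ee.
have /span_consP[b [w' [sw' xw']]] := hE _ Ex.
have a0 : a != 0.
  by apply/eqP => a0; apply: ne; rewrite ew a0 scale0r add0r.
exists (b / a); rewrite xw' ew scalerDr scalerA divfK //.
rewrite opprD addrACA subrr add0r.
by apply: subspaceB => //; [|apply: subspaceZ => //]; exact: subspace_span.
Qed.

(** [fin_dim] only gives a span containing [E]; an exact spanning list is what lets
    [closed_add_span] apply to a kernel. *)
Lemma subspace_fin_dim E s : subspace E -> E `<=` span s ->
  exists s', E = span s'.
Proof.
elim: s E => [|v s IH] E sE hE.
  exists [::]; apply/seteqP; split=> // x /span_nil ->; exact: sE.1.
have [s' hs'] : exists s', E `&` span s = span s'.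
  by apply: IH; [apply: subspace_setI => //; exact: subspace_span|move=> x []].
have [hs|] := pselect (E `<=` span s).
  by exists s'; rewrite -hs' (setIidl hs).
move=> /existsNP[e /not_implyP[Ee ne]].
exists (e :: s'); apply/seteqP; split=> x.
  move=> Ex; have [a xa] := span_cons_exchange sE hE Ee ne Ex.
  apply/span_consP; exists a, (x - a *: e); split; last by rewrite addrC subrK.
  by rewrite -hs'; split=> //; apply: subspaceB => //; exact: subspaceZ.
move=> /span_consP[a [w []]]; rewrite -hs' => -[Ew _] ->.
by apply: subspaceD => //; exact: subspaceZ.
Qed.

(** Induction on the list replaces a dimension count. If no [E n] fits into [span s], the
    intersections with [span s] stabilize, and each later [E (m + n)] still has a vector outside
    [span s] that supplies the missing direction. *)
Lemma fin_dim_chain_stable (E : nat -> set X) s :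
  (forall n, subspace (E n)) -> (forall n, E n.+1 `<=` E n) ->
  E 0%N `<=` span s -> exists n, forall m, E n `<=` E (m + n)%N.
Proof.
elim: s E => [|v s IH] E sE decr hE.
  by exists 0%N => m x /hE/span_nil ->; exact: (sE _).1.
have decr' m n : E (m + n)%N `<=` E n.
  by elim: m => // m IHm x /decr; exact: IHm.
have hE' n : E n `<=` span (v :: s).
  by move=> x; rewrite -[n]addn0 => /decr'/hE.
have [[n hn]|H] := pselect (exists n, E n `<=` span s).
  have [k hk] := IH (fun k => E (k + n)%N) (fun=> sE _) (fun k => @decr _) hn.
  by exists (k + n)%N => m; rewrite addnA; exact: hk.
have [|n x [Ex sx]|x [_]//|n hn] := IH (fun n => E n `&` span s).
- by move=> n; apply: subspace_setI => //; exact: subspace_span.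
- by split=> //; exact: decr Ex.
exists n => m x Ex.
have /existsNP[e /not_implyP[Ee ne]] : ~ (E (m + n)%N `<=` span s).
  by move=> h; apply: H; exists (m + n)%N.
have [a xa] := span_cons_exchange (sE n) (@hE' n) (decr' _ _ _ Ee) ne Ex.
have [|h _] := hn m (x - a *: e).
  split=> //; apply: subspaceB => //; apply: subspaceZ => //; exact: decr' Ee.
by rewrite -(subrK (a *: e) x); apply: subspaceD => //; exact: subspaceZ.
Qed.

Lemma subspace_set_add M N : subspace M -> subspace N -> subspace (set_add M N).
Proof.
move=> sM sN; split; first by exists 0, 0; rewrite addr0; split; [exact: sM.1|exact: sN.1|].
move=> a _ _ [m [n [Mm Nn ->]]] [m' [n' [Mm' Nn' ->]]].
exists (a *: m + m'), (a *: n + n'); split; [exact: sM.2|exact: sN.2|].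
by rewrite scalerDr addrACA.
Qed.

(** For [v] outside [W], the positive distance [d] from [v] to [W] bounds the coefficient of [v] in
    terms of the whole sum, so coefficients along an approximating sequence converge. *)
Lemma closed_add_line W v : subspace W -> closed W ->
  closed (set_add W (span [:: v])).
Proof.
move=> sW cW; have hline x : set_add W (span [:: v]) x <->
    exists a w, W w /\ x = w + a *: v.
  split=> [[w [_ [Ww /span_consP[a [u [/span_nil -> ->]]] ->]]]|[a [w [Ww ->]]]].
    by exists a, w; rewrite addr0.
  exists w, (a *: v); split=> //; apply/span_consP; exists a, 0.
  by rewrite addr0; split=> //; exact: (subspace_span [::]).1.
have [Wv|nWv] := pselect (W v).
  rewrite (_ : set_add W _ = W) //; apply/seteqP; split=> x.
    move=> /hline[a [w [Ww ->]]].
    by apply: subspaceD => //; exact: subspaceZ.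
  by move=> Wx; apply/hline; exists 0, x; rewrite scale0r addr0.
have [d d0 hd] : exists2 d : R, 0 < d & forall w, W w -> d <= rnorm (v - w).
  apply: contrapT => h; apply: nWv; move/closed_rnormP: cW; apply => e e0.
  apply: contrapT => h'; apply: h; exists e => // w Ww.
  by rewrite leNgt; apply/negP => h''; apply: h'; exists w.
have hd' a w : W w -> rnorm a * d <= rnorm (w + a *: v).
  move=> Ww; have [->|a0] := eqVneq a 0.
    by rewrite rnorm0 mul0r; exact: rnorm_ge0.
  have -> : w + a *: v = a *: (v - (- a^-1) *: w).
    by rewrite scaleNr opprK scalerDr scalerA mulfV // scale1r addrC.
  rewrite rnormZ; apply: ler_wpM2l; first exact: rnorm_ge0.
  by apply: hd; exact: subspaceZ.
apply/closed_rnormP => z hz.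
have h2 n : 0 < (2^-1 : R) ^+ n by rewrite exprn_gt0 // invr_gt0.
have step n : exists p : R[i] * X, W p.2 /\
    rnorm (z - (p.2 + p.1 *: v)) < 2^-1 ^+ n.
  by have [_ /hline[a [w [Ww ->]]] h] := hz _ (h2 n); exists (a, w).
have [f hf] := choice step.
pose e n : R := 2 * 2^-1 ^+ n / d.
have [c hc] : exists c, forall n, rnorm (c - (f n).1) <= 2 * e n.
  apply: (@complete_modulus_complex _ (fun n => (f n).1)) => n m nm.
  rewrite /e ler_pdivlMr //.
  have [Wm zm] := hf m; have [Wn zn] := hf n.
  have := hd' ((f m).1 - (f n).1) _ (subspaceB sW Wm Wn).
  have -> : (f m).2 - (f n).2 + ((f m).1 - (f n).1) *: v =
      ((f m).2 + (f m).1 *: v) - ((f n).2 + (f n).1 *: v).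
    by rewrite scalerBl opprD addrACA.
  move=> /le_trans; apply; apply: (le_trans (rnorm_triangle z _ _)).
  have : (2^-1 : R) ^+ m <= 2^-1 ^+ n by apply: ler_wiXn2l => //; lra.
  rewrite rnorm_distC; lra.
apply/hline; exists c, (z - c *: v); split; last by rewrite subrK.
move/closed_rnormP: cW; apply => eps eps0.
have q01 : 0 <= (2^-1 : R) < 1 by lra.
have [n hn] := geometric_small (1 + 4 / d * rnorm v) q01 eps0.
have [Wn zn] := hf n; exists (f n).2 => //; apply: le_lt_trans hn.
have -> : z - c *: v - (f n).2 =
    (z - ((f n).2 + (f n).1 *: v)) - (c - (f n).1) *: v.
  by rewrite scalerBl opprB opprD !addrA addrNK addrAC.
apply: (le_trans (rnormB _ _)); rewrite rnormZ.
have := ler_wpM2r (rnorm_ge0 v) (hc n); rewrite /e => h.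
rewrite mulrDl mul1r; apply: lerD; first exact: ltW.
by apply: (le_trans h); rewrite le_eqVlt; apply/orP; left; apply/eqP; field; rewrite gt_eqF.
Qed.

Lemma closed_add_span W s : subspace W -> closed W -> closed (set_add W (span s)).
Proof.
elim: s W => [|v s IH] W sW cW.
  rewrite (_ : set_add W _ = W) //; apply/seteqP; split=> x.
    by move=> [w [_ [Ww /span_nil -> ->]]]; rewrite addr0.
  move=> Wx; exists x, 0; rewrite addr0; split=> //.
  exact: (subspace_span [::]).1.
have := IH _ (subspace_set_add sW (subspace_span [:: v])) (@closed_add_line _ v sW cW).
congr closed; apply/seteqP; split=> x.
  move=> [_ [u [[w [_ [Ww /span_consP[a [_ [/span_nil -> ->]]] ->]]] su ->]]].
  exists w, (a *: v + u); rewrite addr0 addrA; split=> //.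
  by apply/span_consP; exists a, u.
move=> [w [_ [Ww /span_consP[a [u [su ->]]] ->]]].
exists (w + a *: v), u; rewrite addrA; split=> //; exists w, (a *: v); split=> //.
apply/span_consP; exists a, 0; rewrite addr0; split=> //.
exact: (subspace_span [::]).1.
Qed.

Lemma subspace_ker_on S N : bounded_op S -> subspace N -> subspace (ker_on S N).
Proof.
move=> bS sN; apply: subspace_setI => //; split; first exact: bounded_op0.
by move=> a x y /= Sx Sy; rewrite bS.1 Sx Sy scaler0 addr0.
Qed.

Lemma closed_image_fin_dim_ker S N Z : bounded_op S -> subspace N -> closed N ->
  closed (S @` N) -> fin_dim (ker_on S N) ->
  subspace Z -> closed Z -> Z `<=` N -> closed (S @` Z).
Proof.
move=> bS sN cN cR [s hs] sZ cZ ZN.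
have [s' ks'] := subspace_fin_dim (subspace_ker_on bS sN) hs.
have cW : closed (set_add Z (ker_on S N)) by rewrite ks'; exact: closed_add_span.
have [C C0 hC] := open_mapping bS sN cN cR.
apply/closed_rnormP => y hy.
have [x Nx Sx] : (S @` N) y.
  move/closed_rnormP: cR; apply => e e0; have [_ [z Zz <-] h] := hy _ e0.
  by exists (S z) => //; exists z => //; exact: ZN.
suff [z [k [Zz [_ Sk] xzk]]] : set_add Z (ker_on S N) x.
  by exists z => //; rewrite -Sx xzk bounded_opD // Sk addr0.
move/closed_rnormP: cW; apply => e e0.
have eC : 0 < e / C by rewrite divr_gt0.
have [_ [z Zz <-] yz] := hy _ eC.
have [|u [Nu Su uC]] := hC (y - S z).
  by exists (x - z); [apply: subspaceB => //; exact: ZN|rewrite bounded_opB // Sx].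
exists (x - u).
  exists z, (x - u - z); split=> //; last by rewrite [RHS]addrC subrK.
  split; first by apply: subspaceB => //; [exact: subspaceB|exact: ZN].
  by rewrite /= !bounded_opB // Sx Su opprB addrCA subrr addr0 subrr.
rewrite subKr; apply: (le_lt_trans uC); rewrite mulrC -ltr_pdivlMr //.
Qed.

End FiniteDimension.

(** * Bijectivity near 0 for operators with closed range and finite-dimensional kernel *)

Section Fredholm.
Context {R : realType} {X : completeNormedModType R[i]}.
Implicit Types (S : X -> X) (E M N W Y Z : set X) (s : seq X).

Lemma iter_shift_comm S l n x : bounded_op S ->
  iter n S (shift S l x) = shift S l (iter n S x).
Proof.
move=> bS; elim: n => //= n ->.
by rewrite /shift bounded_opB // bounded_opZ.
Qed.

(** Modulo [Z] the operator is nilpotent. An eigenvector for [v] is a multiple of its n-th iterate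
    and so lies in [Z]; a preimage of [S z] yields one of [z], which allows induction on the number
    of steps into [Z]. *)
Lemma bij_on_shift_iter S N Z n v :
  bounded_op S -> subspace N -> invariant S N -> subspace Z -> Z `<=` N ->
  iter n S @` N `<=` Z -> v != 0 -> bij_on (shift S v) Z ->
  bij_on (shift S v) N.
Proof.
move=> bS sN iN sZ ZN SZ v0 [inj surj]; split.
  move=> x Nx Sx; apply: inj => //.
  have vx k : iter k S x = v ^+ k *: x.
    elim: k => [|k IH]; first by rewrite scale1r.
    rewrite /= IH bounded_opZ //; move/eqP: Sx; rewrite subr_eq0 => /eqP ->.
    by rewrite scalerA -exprSr.
  rewrite -(scale1r x) -(@mulVf _ (v ^+ n)) ?expf_neq0 // -scalerA -vx.
  by apply: subspaceZ => //; apply: SZ; exists x.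
suff nil k z : N z -> Z (iter k S z) -> exists2 x, N x & shift S v x = z.
  by move=> y Ny; apply: (nil n) => //; apply: SZ; exists y.
elim: k z => [|k IH] z Nz /= Zz.
  by have [x Zx <-] := surj _ Zz; exists x => //; exact: ZN Zx.
have [||x Nx Sx] := IH (S z); first by apply: iN; exists z.
  by rewrite -iterSr.
(* As [shift S v x = S z], the shift sends [x - z] to [v *: z]. *)
exists (v^-1 *: (x - z)); first by apply: subspaceZ => //; exact: subspaceB.
have bv := bounded_op_shift v bS.
rewrite (bounded_opZ _ _ bv) (bounded_opB _ _ bv) Sx {1}/shift subKr.
by rewrite scalerA mulVf // scale1r.
Qed.

(* Once the decreasing chain of kernels of [S] on [S ^ n (N)] is stationary,
   [S] is Kato on [S ^ n (N)], and it is nilpotent modulo that space. *)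
Lemma Fredholm_bij_near S N :
  bounded_op S -> subspace N -> closed N -> invariant S N ->
  closed (S @` N) -> fin_dim (ker_on S N) ->
  arbitrarily_small (fun v => bij_on (shift S v) N) ->
  exists2 d : R, 0 < d &
    forall v, v != 0 -> rnorm v < d -> bij_on (shift S v) N.
Proof.
move=> bS sN cN iN cR fk small.
pose Y n := iter n S @` N.
have YS n : Y n.+1 = S @` Y n.
  apply/seteqP; split=> [_ [x Nx <-]|_ [_ [x Nx <-] <-]]; last by exists x.
  by exists (iter n S x) => //; exists x.
have sY n : subspace (Y n) by apply: subspace_image => //; exact: bounded_op_iter.
have YN n : Y n `<=` N by move=> _ [x Nx <-]; exact: invariant_iter.
have cY n : closed (Y n).
  elim: n => [|n IH]; first by rewrite /Y image_id.
  rewrite YS; exact: closed_image_fin_dim_ker cR _ _ _ _.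
have decr n : Y n.+1 `<=` Y n.
  by move=> _ [x Nx <-]; exists (S x); [apply: iN; exists x|rewrite -iterSr].
have [s hs] := fk.
have [|||n hn] := @fin_dim_chain_stable _ _ (fun n => ker_on S (Y n)) s.
- by move=> n; exact: subspace_ker_on.
- by move=> n x [/decr].
- by move=> x [/YN Nx Sx]; apply: hs.
have iY : invariant S (Y n) by move=> x; rewrite -YS; exact: decr.
have KY : Kato_on S (Y n).
  split; first by rewrite -YS.
  move=> m x /(hn m)[[z Nz <-] _]; exists (iter n S z); first by exists z.
  by rewrite iterD.
have [d d0 hd] : exists2 d : R, 0 < d &
    forall v, rnorm v < d -> bij_on (shift S v) (Y n).
  (* Bijectivity passes from [N] to [Y n]: injectivity by inclusion, surjectivity because [iter n S]
     commutes with the shift. *)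
  apply: Kato_bij_near => // e /small[v ve [inj surj]]; exists v => //; split.
    by move=> x /YN; exact: inj.
  move=> _ [x Nx <-]; have [z Nz <-] := surj _ Nx.
  by exists (iter n S z); [exists z|rewrite iter_shift_comm].
exists d => // v v0 /hd; apply: (@bij_on_shift_iter _ _ _ n) => //; exact: YN.
Qed.

End Fredholm.

(** * Boundary points in punctured discs of the complex plane *)

Section ComplexPlane.
Context {R : realType}.
Implicit Types (A : set R[i]) (l p q : R[i]).

Lemma nbhs_complexP l A :
  nbhs l A <-> exists2 e : R, 0 < e & forall y, rnorm (l - y) < e -> A y.
Proof. exact: (@nbhs_rnormP R R[i]^o l A). Qed.

Lemma boundaryP A l : boundary A l <->
  (forall e : R, 0 < e -> exists2 y, A y & rnorm (l - y) < e) /\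
  (forall e : R, 0 < e -> exists2 y, ~ A y & rnorm (l - y) < e).
Proof.
split=> [[clA nintA]|[hA hnA]].
  split=> e e0.
    have [|y [Ay ly]] := clA [set y | rnorm (l - y) < e]; last by exists y.
    by apply/nbhs_complexP; exists e.
  apply: contrapT => h; apply: nintA; apply/nbhs_complexP; exists e => // y ly.
  by apply: contrapT => nAy; apply: h; exists y.
split=> [B /nbhs_complexP[e e0 hB]|/nbhs_complexP[e e0 hA']].
  by have [y Ay ly] := hA _ e0; exists y; split=> //; exact: hB.
by have [y nAy ly] := hnA _ e0; apply: nAy; exact: hA'.
Qed.

Lemma isolated_complexP A l : isolated A l <->
  A l /\ exists2 e : R, 0 < e & forall y, A y -> rnorm (l - y) < e -> y = l.
Proof.
split=> [[/set_mem Al [V /nbhs_complexP[e e0 hV] VA]]|[Al [e e0 he]]].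
  split=> //; exists e => // y Ay ly.
  have : (V `&` A) y by split=> //; exact: hV.
  by rewrite VA.
split; first exact/mem_set.
exists [set y | rnorm (l - y) < e]; first by apply/nbhs_complexP; exists e.
apply/seteqP; split=> y; first by case=> ly Ay; exact: he.
by move=> ->; split=> //=; rewrite subrr rnorm0.
Qed.

Let seg p q (t : R) : R[i] := ((1 - t)%:C%C * p + t%:C%C * q)%R.

Lemma rnorm_segB p q t t' :
  rnorm (seg p q t - seg p q t') = `|t - t'| * rnorm (q - p).
Proof.
rewrite -rnorm_real -rnormM; congr rnorm.
by rewrite /seg !rmorphB /= rmorph1; ring.
Qed.

(** The supremum of the parameters in [A] works: points outside [A] lie just beyond it or, if that
    leaves the segment, at its end [q]. *)
Lemma boundary_segment A l p q : A (l + p) -> ~ A (l + q) ->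
  exists2 t : R, 0 <= t <= 1 & boundary A (l + seg p q t).
Proof.
move=> Ap nAq.
have s0 : seg p q 0 = p by rewrite /seg subr0 rmorph1 rmorph0 mul0r addr0 mul1r.
have s1 : seg p q 1 = q by rewrite /seg subrr rmorph1 rmorph0 mul0r add0r mul1r.
pose E := [set t : R | 0 <= t <= 1 /\ A (l + seg p q t)].
have E0 : E 0 by rewrite /E /= s0 lexx ler01.
have hE : has_sup E by split; [exists 0|exists 1 => t [/andP[]]].
have t0 : 0 <= sup E by exact: (ub_le_sup hE.2 E0).
have t1 : sup E <= 1 by apply: ge_sup; [exists 0|move=> t [/andP[]]].
have close (e : R) : 0 < e -> exists2 d : R, 0 < d & forall t, `|sup E - t| < d ->
    rnorm (l + seg p q (sup E) - (l + seg p q t)) < e.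
  move=> e0; have n0 := rnorm_ge0 (q - p).
  exists (e / (rnorm (q - p) + 1)); first by rewrite divr_gt0 //; lra.
  move=> t; rewrite ltr_pdivlMr; last by lra.
  rewrite opprD addrACA subrr add0r rnorm_segB mulrDr.
  by have := normr_ge0 (sup E - t); lra.
exists (sup E); first by rewrite t0.
apply/boundaryP; split=> e /close[d d0 hd].
  have [t [t01 At] ht] := sup_adherent d0 hE.
  exists (l + seg p q t) => //; apply: hd.
  have := sup_upper_bound hE (conj t01 At).
  by move=> h; rewrite ger0_norm; lra.
have [h|h] := leP (sup E + d / 2) 1.
  exists (l + seg p q (sup E + d / 2)).
    move=> At; have : E (sup E + d / 2) by split=> //; apply/andP; split; lra.
    by move=> /(sup_upper_bound hE); lra.
  by apply: hd; rewrite opprD addrA subrr sub0r normrN ger0_norm; lra.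
exists (l + seg p q 1); first by rewrite s1.
by apply: hd; rewrite ler0_norm; lra.
Qed.

Lemma boundary_segment_disc A l p q (d : R) : A (l + p) -> ~ A (l + q) ->
  rnorm p < d -> rnorm q < d -> (forall t, 0 <= t <= 1 -> seg p q t != 0) ->
  exists m, [/\ boundary A (l + m), m != 0 & rnorm m < d].
Proof.
move=> Ap nAq pd qd h; have [t t01 bt] := boundary_segment Ap nAq.
exists (seg p q t); split=> //; first exact: h.
apply: (le_lt_trans (rnormD _ _)); rewrite !rnormM !rnorm_real.
move: t01 => /andP[t0 t1]; rewrite !ger0_norm //; last by lra.
have := ler_wpM2l t0 (ltW qd).
have [->|tn1] := eqVneq t 1; first by rewrite subrr mul0r add0r mul1r.
have t1' : 0 < 1 - t by rewrite subr_gt0 lt_neqAle tn1.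
have : (1 - t) * rnorm p < (1 - t) * d by rewrite ltr_pM2l.
lra.
Qed.

(* If the segment from [p] to [q] meets [0], detour through ['i * p]. *)
Lemma boundary_punctured_disc A l p q (d : R) : A (l + p) -> ~ A (l + q) ->
  p != 0 -> q != 0 -> rnorm p < d -> rnorm q < d ->
  exists m, [/\ boundary A (l + m), m != 0 & rnorm m < d].
Proof.
move=> Ap nAq p0 q0 pd qd.
have [h|] := pselect (forall t, 0 <= t <= 1 -> seg p q t != 0).
  exact: boundary_segment_disc h.
move=> /existsNP[t /not_implyP[/andP[t0 t1] /negP/negPn/eqP st]].
have tn0 : t != 0.
  apply: contra_not_neq (elimN eqP p0) => te; rewrite -st te /seg.
  by rewrite subr0 rmorph1 rmorph0 mul0r addr0 mul1r.
pose s := (1 - t) / t.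
have qE : q = - (s%:C%C * p).
  have tC : (t%:C%C : R[i]) != 0 by apply/eqP => /complexI/eqP; exact/negP.
  apply: (mulfI tC); rewrite mulrN mulrA -rmorphM /= /s mulrCA mulfV // mulr1.
  by apply/eqP; rewrite -addr_eq0 addrC; apply/eqP.
pose r : R[i] := ('i%C * p)%R.
have rd : rnorm r < d.
  rewrite rnormM (_ : rnorm _ = 1) ?mul1r //.
  by rewrite /rnorm normc_def /= expr0n expr1n add0r sqrtr1.
have combo (a b : R) : (a%:C%C + b%:C%C * 'i%C : R[i]) = 0 -> a = 0 /\ b = 0.
  move=> /eqP; rewrite eq_complex => /andP[/eqP + /eqP].
  by move=> /= h1 h2; split; lra.
(* In either case one leg, from [r] to [q] or from [p] to [r], starts in [A] and ends outside.
   Points of a leg are [p] times a real combination of 1 and ['i] whose coefficients do not both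
   vanish. *)
have [Ar|nAr] := pselect (A (l + r)).
  apply: (boundary_segment_disc Ar nAq rd qd) => u u01; apply/eqP => su.
  have : p * ((- (u * s))%:C%C + (1 - u)%:C%C * 'i%C) = 0.
    by rewrite -su /seg /r qE rmorphN rmorphM /=; ring.
  move=> /eqP; rewrite mulf_eq0 (negPf p0) /= => /eqP/combo[us u1].
  have u1' : u = 1 by lra.
  have s0 : s = 0 by move: us; rewrite u1'; lra.
  by move: q0; rewrite qE s0 rmorph0 mul0r oppr0 eqxx.
apply: (boundary_segment_disc Ap nAr pd rd) => u u01; apply/eqP => su.
have : p * ((1 - u)%:C%C + u%:C%C * 'i%C) = 0 by rewrite -su /seg /r; ring.
by move=> /eqP; rewrite mulf_eq0 (negPf p0) /= => /eqP/combo[]; lra.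
Qed.

End ComplexPlane.

(** * Decompositions and the isolated boundary point *)

Section Decompositions.
Context {R : realType} {X : completeNormedModType R[i]}.
Implicit Types (S : X -> X) (M N : set X).

Lemma bijective_bij_on S : bounded_op S -> bijective S <-> bij_on S setT.
Proof.
move=> bS; split=> [[g gK Kg]|[inj surj]].
  split=> [x _ Sx|y _]; last by exists (g y).
  by rewrite -(gK x) -(gK 0) Sx (bounded_op0 bS).
have step y : exists x, S x = y by have [x _ Sx] := surj y I; exists x.
have [g hg] := choice step.
exists g => // x; apply/eqP; rewrite -subr_eq0; apply/eqP/inj => //.
by rewrite bounded_opB // hg subrr.
Qed.

Lemma bijective_direct_sum S M N : bounded_op S -> direct_sum M N ->
  invariant S M -> invariant S N ->
  bijective S <-> bij_on S M /\ bij_on S N.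
Proof.
move=> bS [sM sN MN0 MN] iM iN.
have MN_eq a b a' b' : M a -> M a' -> N b -> N b' -> a + b = a' + b' ->
    a = a' /\ b = b'.
  move=> Ma Ma' Nb Nb' e.
  have e' : a - a' = b' - b.
    by apply/eqP; rewrite subr_eq addrAC eq_sym subr_eq addrC e addrC.
  have : (M `&` N) (a - a').
    by split; [exact: subspaceB|rewrite e'; exact: subspaceB].
  rewrite MN0 => /= d0; split; first exact: subr0_eq.
  by apply/esym/subr0_eq; rewrite -e'.
rewrite bijective_bij_on //; split=> [[inj surj]|[[iM1 sM1] [iN1 sN1]]].
  split; (split=> [x _|y Ky]; first exact: inj);
      have [x _ Sx] := surj y I; have [a [b [Ma Nb xab]]] := MN x;
      move: Sx; rewrite xab bounded_opD // => Sx;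
      have MSa : M (S a) by [apply: iM; exists a];
      have NSb : N (S b) by apply: iN; exists b.
    by exists a => //; have [] := MN_eq _ _ y 0 MSa Ky NSb sN.1; rewrite ?addr0.
  by exists b => //; have [] := MN_eq _ _ 0 y MSa sM.1 NSb Ky; rewrite ?add0r.
split=> [x _|y _].
  have [a [b [Ma Nb ->]]] := MN x; rewrite bounded_opD // => Sab.
  have [|||||Sa Sb] := MN_eq (S a) (S b) 0 0.
  - by apply: iM; exists a.
  - exact: sM.1.
  - by apply: iN; exists b.
  - exact: sN.1.
  - by rewrite Sab addr0.
  by rewrite (iM1 _ Ma Sa) (iN1 _ Nb Sb) addr0.
have [a [b [Ma Nb ->]]] := MN y.
have [a' _ <-] := sM1 _ Ma; have [b' _ <-] := sN1 _ Nb.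
by exists (a' + b') => //; rewrite bounded_opD.
Qed.

Lemma decomposition_mono S (P P' Q Q' : (X -> X) -> set X -> Prop) :
  (forall M, closed M -> P S M -> P' S M) ->
  (forall N, subspace N -> invariant S N -> Q S N -> Q' S N) ->
  decomposition S P Q -> decomposition S P' Q'.
Proof.
move=> PP QQ [M [N [[cM cN iM iN] [dMN PM QN]]]]; exists M, N; split=> //.
by split=> //; [exact: PP|apply: QQ => //; case: dMN].
Qed.

Lemma subspace_set0 : subspace [set (0 : X)].
Proof. by split=> // a x y /= -> ->; rewrite scaler0 addr0. Qed.

Lemma closed_set0 : closed [set (0 : X)].
Proof.
apply/closed_rnormP => x hx /=; apply: rnorm_eps0 => e /hx[_ -> ].
by rewrite subr0.
Qed.

Lemma decomposition_setT S (P Q : (X -> X) -> set X -> Prop) :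
  bounded_op S -> P S setT -> Q S [set 0] -> decomposition S P Q.
Proof.
move=> bS PT Q0; exists setT, [set 0]; split; split=> //.
- exact: closed_set0.
- by move=> _ [_ -> <-]; exact: bounded_op0.
- split=> //; [exact: subspace_set0|by rewrite setTI|].
  by move=> x; exists x, 0; rewrite addr0.
Qed.

Lemma surjective_on_Kato S M : closed M -> surjective_on S M -> Kato_on S M.
Proof.
move=> cM SM; split; first by rewrite SM.
move=> n x [Mx _]; suff -> : iter n S @` M = M by [].
elim: n => [|n IH]; first exact: image_id.
by rewrite -[RHS]SM -[in RHS]IH image_comp.
Qed.

Lemma nilpotent_quasinilpotent S N : bounded_op S -> subspace N ->
  invariant S N -> nilpotent_on S N -> quasinilpotent_on S N.
Proof.
move=> bS sN iN [n Sn] l; apply: contra_notP => /eqP l0.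
have [|||||inj surj] := @bij_on_shift_iter _ _ S N [set 0] n l bS sN iN.
- exact: subspace_set0.
- by move=> _ ->; exact: sN.1.
- by move=> _ [x Nx <-]; exact: Sn.
- exact: l0.
- split=> [x _ //|_ ->]; exists 0 => //.
  by apply: bounded_op0; exact: bounded_op_shift.
split=> [x y Nx Ny Sxy|]; last first.
  by apply: image_bij_on => //; exact: invariant_shift.
apply: subr0_eq; apply: inj; first exact: subspaceB.
by rewrite bounded_opB ?Sxy ?subrr //; exact: bounded_op_shift.
Qed.

Lemma quasinilpotent_Riesz S N : bounded_op S -> closed N -> subspace N ->
  quasinilpotent_on S N -> Riesz_on S N.
Proof.
move=> bS cN sN qS l l0.
have [inj surj] : (forall x y, N x -> N y -> shift S l x = shift S l y -> x = y)
    /\ shift S l @` N = N.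
  by apply: contrapT => /qS /= /eqP; rewrite (negPf l0).
have z0 : span [::] (0 : X) by exact: (subspace_span [::]).1.
split; last 2 first.
- by rewrite surj.
- exists [::]; split=> // x Nx; rewrite surj; exists x, 0.
  by rewrite addr0.
exists [::] => x [Nx Sx]; rewrite (inj x 0) //; first exact: sN.1.
by rewrite Sx bounded_op0 //; exact: bounded_op_shift.
Qed.

Lemma continuous_bounded_op (T : {linear X -> X}) : continuous T -> bounded_op T.
Proof.
move=> cT; split; first by move=> a x y; rewrite linearP.
have : nbhs (T 0) [set y | rnorm (T 0 - y) < 1] by apply/nbhs_rnormP; exists 1.
move=> /cT /nbhs_rnormP[e e0 he].
have e2 : 0 < 2 / e by rewrite divr_gt0.
exists (2 / e) => [|x]; first exact: ltW.
have [->|x0] := eqVneq x 0; first by rewrite linear0 !rnorm0 mulr0.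
have nx : 0 < rnorm x by rewrite rnorm_gt0.
have t0 : 0 < e / (2 * rnorm x) by rewrite divr_gt0 // mulr_gt0.
pose t : R[i] := ((e / (2 * rnorm x))%:C)%C.
have := he (t *: x).
rewrite /= linear0 !sub0r !rnormN linearZ !rnormZ rnorm_real gtr0_norm // => h.
have {h} : e / (2 * rnorm x) * rnorm (T x) < 1.
  apply: h; rewrite (_ : _ * _ = e / 2); first by lra.
  by field; rewrite gt_eqF.
rewrite mulrC -ltr_pdivlMr // => /ltW/le_trans; apply.
rewrite le_eqVlt; apply/orP; left; apply/eqP; field.
by rewrite !gt_eqF.
Qed.

Lemma shift_shift S (l v : R[i]) : shift (shift S l) v = shift S (l + v).
Proof. by apply/funext => x; rewrite /shift scalerDl opprD addrA. Qed.

Lemma GKRD_boundary_isolated S (l : R[i]) :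
  bounded_op S -> boundary (spectrum S) l -> spectrum S l ->
  GKRD (shift S l) -> exists2 m, boundary (spectrum S) m & isolated (spectrum S) m.
Proof.
move=> bS bl sl [M [N [[cM cN iM iN] [dMN KM RN]]]].
have [sM sN _ _] := dMN; set A := shift S l in iM iN KM RN.
have bA : bounded_op A by exact: bounded_op_shift.
have bij v : bijective (shift S (l + v)) <->
    bij_on (shift A v) M /\ bij_on (shift A v) N.
  rewrite /A shift_shift -shift_shift; apply: bijective_direct_sum => //.
  - exact: bounded_op_shift.
  - exact: invariant_shift.
  - exact: invariant_shift.
(* Needed twice: with [m = 0] for the Kato part, and at the nearby boundary point for the Riesz
   part. *)
have small m : boundary (spectrum S) (l + m) ->
    arbitrarily_small (fun v => bijective (shift S (l + m + v))).
  move=> /boundaryP[_ h] e /h[y /contrapT by_ ly]; exists (y - (l + m)).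
    by rewrite rnorm_distC.
  by rewrite addrC subrK.
have [d d0 hd] : exists2 d : R, 0 < d & forall v, rnorm v < d -> bij_on (shift A v) M.
  apply: Kato_bij_near => // e e0.
  have [|v ve bv] := small 0 _ _ e0; first by rewrite addr0.
  by exists v => //; move: bv; rewrite addr0 => /bij[].
have [isol|nisol] := pselect (isolated (spectrum S) l); first by exists l.
have [p [p0 pd sp]] : exists p, [/\ p != 0, rnorm p < d & spectrum S (l + p)].
  apply: contrapT => h; apply: nisol; apply/isolated_complexP; split=> //.
  exists d => // y sy ly; apply: contrapT => yl; apply: h; exists (y - l).
  by rewrite subr_eq0 rnorm_distC subrKC; split=> //; apply/eqP.
have [q [q0 qd sq]] : exists q, [/\ q != 0, rnorm q < d & ~ spectrum S (l + q)].
  move/boundaryP: bl => [_ /(_ _ d0)[y sy ly]]; exists (y - l).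
  rewrite subr_eq0 rnorm_distC subrKC; split=> //.
  by apply/eqP => yl; apply: sy; rewrite yl.
have [m [bm m0 md]] := boundary_punctured_disc sp sq p0 q0 pd qd.
exists (l + m) => //.
have [fk cR _] := RN m m0.
have bAm := bounded_op_shift m bA.
have [d' d'0 hd'] : exists2 d' : R, 0 < d' &
    forall v, v != 0 -> rnorm v < d' -> bij_on (shift (shift A m) v) N.
  apply: Fredholm_bij_near => //; first exact: invariant_shift.
  move=> e /(small _ bm)[v ve bv]; exists v => //.
  by move: bv; rewrite shift_shift -addrA => /bij[].
(* The second bound keeps [m + v] in the disc where the part on [M] is bijective. *)
pose r := Num.min d' (d - rnorm m).
have r0 : 0 < r by rewrite lt_min d'0 subr_gt0.
have near v : v != 0 -> rnorm v < r -> ~ spectrum S (l + m + v).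
  rewrite lt_min => v0 /andP[vd' vd]; apply; rewrite -addrA; apply/bij; split.
    by apply: hd; apply: (le_lt_trans (rnormD _ _)); lra.
  by rewrite -shift_shift; exact: hd'.
have near' y : spectrum S y -> rnorm (l + m - y) < r -> y = l + m.
  move=> sy ly; apply: contrapT => yn; apply: (near (y - (l + m))).
  - by rewrite subr_eq0; apply/eqP.
  - by rewrite rnorm_distC.
  - by rewrite subrKC.
(* Membership of [l + m] in the spectrum comes without knowing that the spectrum is closed: spectral
   points approach [l + m], and within distance [r] there is no other. *)
apply/isolated_complexP; split; last by exists r.
move/boundaryP: bm => [/(_ _ r0)[y sy ly] _].
by rewrite -(near' _ sy ly).
Qed.

End Decompositions.

Theorem theorem3p23 (R : realType) (X : completeNormedModType R[i])
  (T : {linear X -> X}) (T_cont : continuous T)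
  (X_infdim : ~ fin_dim [set: X])
  (Hsu : spectrum_su T = boundary (spectrum T))
  (Hniso : forall l, boundary (spectrum T) l -> ~ isolated (spectrum T) l) :
  [/\ spectrum_ec T `<=` spectrum_su T,
      spectrum_su T = spectrum_gKR T,
      spectrum_gKR T = spectrum_gK T &
      spectrum_gK T = spectrum_Kt T] /\
  [/\ spectrum_Kt T = spectrum_eK T,
      spectrum_eK T = spectrum_K T &
      spectrum_K T = spectrum_gDRQ T].
Proof.
have bT := continuous_bounded_op T_cont.
have bS l := bounded_op_shift l bT.
pose su l := forall y, exists x, shift T l x = y.
have suT l : su l -> surjective_on (shift T l) setT.
  by move=> h; apply/seteqP; split=> // y _; have [x] := h y; exists x.
have su_K l : su l -> Kato (shift T l).
  by move=> /suT; apply: surjective_on_Kato; exact: closedT.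
have nil0 l : nilpotent_on (shift T l) [set 0] by exists 0%N => x ->.
have K_eK l : Kato (shift T l) -> essentially_Kato (shift T l).
  move=> KT; apply: decomposition_setT => //; split=> //.
  by exists [::] => _ ->; exact: (subspace_span [::]).1.
have eK_Kt l : essentially_Kato (shift T l) -> Kato_type (shift T l).
  by apply: decomposition_mono => // N _ _ [].
have Kt_gK l : Kato_type (shift T l) -> GKD (shift T l).
  by apply: decomposition_mono => // N sN iN; exact: nilpotent_quasinilpotent.
have gK_gKR l : GKD (shift T l) -> GKRD (shift T l).
  move=> [M [N [[cM cN iM iN] [dMN PM QN]]]]; exists M, N; split=> //.
  by split=> //; apply: quasinilpotent_Riesz => //; case: dMN.
have su_gDRQ l : su l -> gDR_Q (shift T l).
  move=> /[dup] /suT sT sl; apply: decomposition_setT => //.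
  have s0 := @subspace_set0 _ X; have c0 := @closed_set0 _ X.
  apply: quasinilpotent_Riesz => //; apply: nilpotent_quasinilpotent => //.
  by move=> _ [_ -> <-]; exact: bounded_op0.
have gDRQ_gKR l : gDR_Q (shift T l) -> GKRD (shift T l).
  by apply: decomposition_mono => // M; exact: surjective_on_Kato.
(* The only arrow that uses the hypotheses on the spectrum; it turns the implications above into
   cycles through [su]. *)
have gKR_su l : GKRD (shift T l) -> su l.
  move=> gl; apply: contrapT => nsu; have bl : boundary (spectrum T) l by rewrite -Hsu.
  have sl : spectrum T l.
    by move=> [g _ Kg]; apply: nsu => y; exists (g y).
  by have [m /Hniso] := GKRD_boundary_isolated bT bl sl gl.
have su_eK l : su l -> essentially_Kato (shift T l) by move=> /su_K/K_eK.
have su_Kt l : su l -> Kato_type (shift T l) by move=> /su_eK/eK_Kt.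
have su_gK l : su l -> GKD (shift T l) by move=> /su_Kt/Kt_gK.
have gK_su l : GKD (shift T l) -> su l by move=> /gK_gKR/gKR_su.
have Kt_su l : Kato_type (shift T l) -> su l by move=> /Kt_gK/gK_su.
have eK_su l : essentially_Kato (shift T l) -> su l by move=> /eK_Kt/Kt_su.
have K_su l : Kato (shift T l) -> su l by move=> /K_eK/eK_su.
have gDRQ_su l : gDR_Q (shift T l) -> su l by move=> /gDRQ_gKR/gKR_su.
have eqC (P : R[i] -> Prop) : (forall l, P l -> su l) ->
    (forall l, su l -> P l) -> [set l | ~ P l] = spectrum_su T.
  by move=> Psu suP; apply/seteqP; split=> l; apply: contra_not; [exact: suP|exact: Psu].
have gKR_E : spectrum_gKR T = spectrum_su T.
  by apply: eqC => // l /su_gK/gK_gKR.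
have gK_E : spectrum_gK T = spectrum_su T by exact: eqC.
have Kt_E : spectrum_Kt T = spectrum_su T by exact: eqC.
have eK_E : spectrum_eK T = spectrum_su T by exact: eqC.
have K_E : spectrum_K T = spectrum_su T by exact: eqC.
have gDRQ_E : spectrum_gDRQ T = spectrum_su T by exact: eqC.
rewrite gKR_E gK_E Kt_E eK_E K_E gDRQ_E; split; split=> //.
move=> l; apply: contra_not => /suT; rewrite /surjective_on => ->.
exact: closedT.
Qed.
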